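(* Let $K$ be a subset of the group $\mathbb{Z}$, and let $f \in L^1(\mathbb{T})$. If there is an enumeration $(k_j)$ of $K$ such that $\hat f$ vanishes on the set $\mathrm{Sch}((k_j))$, then $$\left[\sum_{k\in K}|\hat f(k)|^2\right]^{1/2} \le 2\|f\|_1.$$
   Context: $\mathbb{T}$ is the circle group, identified with $(-\pi,\pi]$ with addition modulo $2\pi$ and equipped with the measure $\frac{1}{2\pi}\,dt$, which is used in $\|f\|_1$ and in $\hat f(n) = \frac{1}{2\pi}\int_{-\pi}^{\pi} f(t)e^{-int}\,dt$. An enumeration $(k_j)$ of $K$ lists the elements of $K$, each once, as a sequence indexed by an interval of integers (finite, one-sided infinite in either direction, or all of $\mathbb{Z}$); no monotonicity of the sequence is required, and no lacunarity of $K$ is required. Given such a sequence $(k_j)$, $\mathrm{Sch}((k_j))$ is the set of all integers $m$ having at least one representation $m=\sum_{j'}\varepsilon_{j'}k_{j'}$ (sum over the index interval) in which the coefficients $\varepsilon_{j'}$ are integers, only finitely many of them are nonzero, and, with the partial sums of the coefficients taken in index order, i.e. $\sigma_j=\sum_{j'\le j}\varepsilon_{j'}$: (1) the full sum $\sum_{j'}\varepsilon_{j'}$ equals $1$; (2) all partial sums $\sigma_j$ are nonnegative; (3) all partial sums after the first positive one are positive; (4) some partial sum is greater than $1$. *)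

(* Defs.v *)
From HB Require Import structures.
From mathcomp Require Import all_boot all_order all_algebra.
From mathcomp Require Import complex.
From mathcomp Require Import all_classical all_reals all_analysis.
Import Order.TTheory GRing.Theory Num.Theory.
Import ComplexField.
Import numFieldNormedType.Exports.

Set Implicit Arguments.
Unset Strict Implicit.
Unset Printing Implicit Defensive.

Local Open Scope classical_set_scope.
Local Open Scope ring_scope.

(* The circle group is modelled by the interval ]-pi, pi]; a function on it is
   a function R -> R[i], of which only the values on ]-pi, pi] matter. *)
Definition circle (R : realType) : set R := [set` `]- pi, pi]].
Arguments circle : clear implicits.

Definition integrable_circle (R : realType) (f : R -> R[i]) : Prop :=
  lebesgue_measure.-integrable (circle R) (fun t => (complex.Re (f t))%:E) /\
  lebesgue_measure.-integrable (circle R) (fun t => (complex.Im (f t))%:E).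

Definition cintegral (R : realType) (f : R -> R[i]) : R[i] :=
  Complex (\int[lebesgue_measure]_(t in circle R) complex.Re (f t))
          (\int[lebesgue_measure]_(t in circle R) complex.Im (f t)).

Definition cis (R : realType) (x : R) : R[i] := Complex (cos x) (sin x).

Definition fourier_coef (R : realType) (f : R -> R[i]) (n : int) : R[i] :=
  ((2 * pi)^-1)%:C%C * cintegral (fun t => f t * cis (- (n%:~R * t))).

Definition norm1 (R : realType) (f : R -> R[i]) : \bar R :=
  (((2 * pi)^-1)%:E *
   \int[lebesgue_measure]_(t in circle R) (Normc.normc (f t))%:E)%E.

(* J is empty only when K is. *)
Definition int_interval (J : set int) : Prop :=
  forall a b c : int, J a -> J c -> a <= b <= c -> J b.

(* Only the values of k on the index set J matter. *)
Definition enumeration (K : set int) (J : set int) (k : int -> int) : Prop :=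
  int_interval J /\ set_bij J K k.

Definition partial_sum (J : set int) (eps : int -> int) (j : int) : int :=
  \sum_(i \in J `&` [set i | i <= j]) eps i.

Definition first_positive (J : set int) (eps : int -> int) (j0 : int) : Prop :=
  [/\ J j0, 0 < partial_sum J eps j0 &
      forall j, J j -> j < j0 -> ~~ (0 < partial_sum J eps j)].

(* The sums over J are finitely supported sums, whose value is 0 by convention
   on an infinite support; the finiteness condition excludes that case. *)
Definition admissible (J : set int) (eps : int -> int) : Prop :=
  finite_set [set j | J j /\ eps j != 0] /\
  [/\ \sum_(j \in J) eps j = 1,
      forall j, J j -> 0 <= partial_sum J eps j,
      forall j0 j, first_positive J eps j0 -> J j -> j0 < j ->
        0 < partial_sum J eps j &
      exists2 j, J j & 1 < partial_sum J eps j].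

Definition Sch (J : set int) (k : int -> int) : set int :=
  [set m | exists2 eps : int -> int,
    admissible J eps & m = \sum_(j \in J) eps j * k j].

(* Main.v *)
Require Import Defs.
From mathcomp Require Import all_boot all_order all_algebra.
From mathcomp Require Import complex.
From mathcomp Require Import all_classical all_reals all_analysis.
From mathcomp Require Import measurable_realfun.
From mathcomp Require Import zify ring lra.
Import Order.TTheory GRing.Theory Num.Theory.
Import ComplexField.
Import numFieldNormedType.Exports.

(* By duality it suffices, for finitely many indices i in increasing order and
   coefficients c_i with 2 * sum |c_i|^2 < 1, to find a function bounded by 1
   of the form sum c_i e^{-i k_i t} + q, where the frequencies of q lie in Sch.
   Such a function is built by a Schur algorithm: g is replaced by
   (g + w) / (1 + w^* g) = w + (1 - |w|^2) sum_m (- w^* )^m g^(m+1) with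
   w = a e^{-i k_b t}. The term m = 0 only rescales g, and for m >= 1 the
   coefficients of the frequencies in (w^* )^m g^(m+1) sum to m + 1 > 1 before
   the index b and to 1 from b on, so that these frequencies lie in Sch. The
   rescaling by 1 - |w|^2 is undone beforehand by replacing c with
   c / (1 - |w|^2), which preserves 2 * sum |c_i|^2 < 1. Truncating the series
   keeps everything a trigonometric polynomial. *)

Set Implicit Arguments.
Unset Strict Implicit.
Unset Printing Implicit Defensive.

Local Open Scope classical_set_scope.
Local Open Scope ring_scope.
Local Open Scope complex_scope.

Local Notation normc := Normc.normc.
Local Notation mu := lebesgue_measure.

(** * Coefficient sequences and the frequencies they produce *)

(** Finite counterpart of [partial_sum]: [s] lists finitely many elements of [J], and [j] ranges
    over all integers. *)
Definition psum (s : seq int) (eps : int -> int) (j : int) : int :=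
  \sum_(i <- s | i <= j) eps i.

(** The sign conditions of [admissible], with positivity propagating from any positive partial sum
    rather than from the first one; this form passes easily to sums of sequences. *)
Definition persistent (s : seq int) (eps : int -> int) : Prop :=
  (forall j, 0 <= psum s eps j) /\
  (forall i j, i <= j -> 0 < psum s eps i -> 0 < psum s eps j).

(** Home of the frequencies of [g ^ n], when [g] has been built from the indices before [b]. *)
Definition reach (k : int -> int) (s : seq int) (b n : int) : set int :=
  [set m | exists eps : int -> int,
    [/\ forall i, b <= i -> eps i = 0, \sum_(i <- s) eps i = n,
        persistent s eps & m = \sum_(i <- s) eps i * k i]].

(** The part of [Sch J k] that uses only indices of [s] before [b]; the bound [b] lets such a
    frequency enter the next step of the algorithm. *)
Definition overshoot (J : set int) (k : int -> int) (s : seq int) (b : int) :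
    set int :=
  [set m | exists eps : int -> int,
    [/\ forall i, b <= i -> eps i = 0, \sum_(i <- s) eps i = 1,
        persistent s eps, exists2 j, J j & 1 < psum s eps j &
        m = \sum_(i <- s) eps i * k i]].

(** The support lies strictly before [b], so the total is already attained at [j = b - 1]. *)
Lemma psum_full (s : seq int) (eps : int -> int) (b j : int) :
  (forall i, b <= i -> eps i = 0) -> b <= j + 1 ->
  psum s eps j = \sum_(i <- s) eps i.
Proof.
move=> eps0 bj; rewrite /psum big_mkcond /=; apply: eq_bigr => i _.
by case: ifPn => // ij; rewrite eps0//; lia.
Qed.

Lemma overshoot_reach (J : set int) (k : int -> int) (s : seq int) (b : int) :
  overshoot J k s b `<=` reach k s b 1.
Proof. by move=> m [eps [e0 e1 ep _ ->]]; exists eps. Qed.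

Lemma overshoot_widen (J : set int) (k : int -> int) (s : seq int)
    (b b' : int) :
  b <= b' -> overshoot J k s b `<=` overshoot J k s b'.
Proof.
move=> bb' m [eps [e0 e1 ep ej ->]]; exists eps; split => // i b'i.
exact/e0/(le_trans bb').
Qed.

(** If the added partial sums are positive at [i], one of the two is; it stays positive later, and
    the other is nonnegative. *)
Lemma reachD (k : int -> int) (s : seq int) (b n n' m m' : int) :
  reach k s b n m -> reach k s b n' m' -> reach k s b (n + n') (m + m').
Proof.
move=> [e [e0 en [ep0 ep] ->]] [e' [e0' en' [ep0' ep'] ->]].
exists (fun i => e i + e' i).
have psumD j : psum s (fun i => e i + e' i) j = psum s e j + psum s e' j.
  by rewrite /psum big_split.
split.
- by move=> i bi; rewrite e0// e0'.
- by rewrite big_split /= en en'.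
- split=> [j|i j ij]; rewrite !psumD; first by rewrite addr_ge0.
  have := ep i j ij; have := ep' i j ij.
  by move: (ep0 i) (ep0' i) (ep0 j) (ep0' j); lia.
- by rewrite -big_split /=; apply: eq_bigr => i _; rewrite mulrDl.
Qed.

Lemma sum_indic (s : seq int) (b : int) (F : int -> int) : uniq s -> b \in s ->
  \sum_(i <- s) (if i == b then F i else 0) = F b.
Proof.
by move=> us bs; rewrite -big_mkcond -big_filter filter_pred1_uniq// big_seq1.
Qed.

Lemma psum_indic (s : seq int) (b j c : int) : uniq s -> b \in s ->
  psum s (fun i => if i == b then c else 0) j = if b <= j then c else 0.
Proof.
move=> us bs; rewrite /psum big_mkcond /=.
rewrite -(sum_indic (fun i => if i <= j then c else 0) us bs).
by apply: eq_bigr => i _; case: eqVneq => [->//|_]; case: ifP.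
Qed.

Lemma reach_index (k : int -> int) (s : seq int) (b i : int) :
  uniq s -> i \in s -> i < b -> reach k s b 1 (k i).
Proof.
move=> us js ij; exists (fun j => if j == i then 1 else 0); split.
- by move=> j bj; rewrite ifF//; apply/negbTE; rewrite gt_eqF//; lia.
- exact: sum_indic.
- by split => [j|j j' jj']; rewrite !psum_indic//; do ?case: ifPn => //; lia.
- rewrite -(sum_indic k us js); apply: eq_bigr => j _.
  by case: ifP; rewrite ?mul1r ?mul0r.
Qed.

(* Subtracting n - 1 copies of k b brings a total of n > 1 back to 1, while
   the partial sum just before b stays at n. *)
Lemma reach_overshoot (J : set int) (k : int -> int) (s : seq int)
    (b b' n m : int) : int_interval J -> uniq s -> [set` s] `<=` J -> b \in s ->
  b < b' -> 1 < n -> reach k s b n m ->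
  overshoot J k s b' (m - (n - 1) * k b).
Proof.
move=> iJ us sJ bs bb' n1 [e [e0 en [ep0 ep] ->]].
pose d i : int := if i == b then 1 - n else 0.
have psumD j : psum s (fun i => e i + d i) j =
    psum s e j + if b <= j then 1 - n else 0.
  by rewrite -(psum_indic j (1 - n) us bs) /psum big_split.
have full j : b <= j + 1 -> psum s e j = n.
  by move=> bj; rewrite (psum_full _ e0).
exists (fun i => e i + d i); split.
- by move=> i bi; rewrite e0 /d ?gt_eqF//; lia.
- by rewrite big_split /= en (sum_indic (fun=> 1 - n) us bs); lia.
(* Before [b] the partial sums are those of [e]; from [b] on they equal [n + (1 - n) = 1]. *)
- split=> [j|i j ij]; rewrite !psumD.
    have := ep0 j; have := full j; case: ifPn; lia.
  have := ep i j ij; have := full i; have := full j; do 2 case: ifPn; lia.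
- exists (b - 1); last by rewrite psumD full ?subrK//; case: ifPn; lia.
  (* The witness [b - 1] must belong to [J]: as [n] is nonzero, some index of [s] is at most
     [b - 1], and [J] is an interval containing this index and [b]. *)
  have [i is_ ib] : exists2 i, i \in s & i <= b - 1.
    apply: contrapT => no; suff : n = 0 by lia.
    rewrite -en big1_seq// => i /= is_; apply: e0; apply: contrapT => bi.
    by apply: no; exists i => //; lia.
  by apply: (iJ i _ b (sJ _ is_) (sJ _ bs)); lia.
- under [RHS]eq_bigr do rewrite mulrDl.
  rewrite big_split /=; congr (_ + _).
  rewrite -mulNr opprB -(sum_indic (fun i => (1 - n) * k i) us bs).
  by apply: eq_bigr => i _; rewrite /d; case: ifP => //; rewrite mul0r.
Qed.

Lemma overshoot_Sch (J : set int) (k : int -> int) (s : seq int) (b : int) :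
  uniq s -> [set` s] `<=` J -> overshoot J k s b `<=` Sch J k.
Proof.
move=> us sJ m [e [e0 e1 [ep0 ep] [j1 Jj1 ej1] ->]].
(* [Sch] sums over all of [J], while nothing is known of [e] before [b] outside [s]; hence the
   cut-off. *)
pose e' i := if i \in s then e i else 0.
have fs (P : pred int) (F : int -> int) : (forall i, i \notin s -> F i = 0) ->
    \sum_(i \in J `&` [set` P]) F i = \sum_(i <- s | P i) F i.
  move=> F0; rewrite -[RHS]big_filter [RHS]fsbig_seq ?filter_uniq//.
  apply/esym; apply: fsbig_widen => [i|i [[Ji Pi]]] /=.
    by rewrite mem_filter => /andP[Pi /sJ].
  by move=> nis; apply: F0; apply/negP => is_; apply: nis;
    rewrite mem_filter is_ andbT.
have e'0 i : i \notin s -> e' i = 0 by rewrite /e' => /negbTE ->.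
have psumE j : partial_sum J e' j = psum s e j.
  rewrite /partial_sum (fs (fun i => i <= j))// /psum.
  rewrite big_seq_cond [RHS]big_seq_cond.
  by apply: eq_bigr => i /andP[is_ _]; rewrite /e' is_.
have fsT (F : int -> int) : (forall i, i \notin s -> F i = 0) ->
    \sum_(i \in J) F i = \sum_(i <- s) F i.
  by move=> /(fs predT) <-; congr (\sum_(i \in _) _);
    apply/seteqP; split=> // i [].
exists e'; last first.
  by rewrite fsT => [|i /e'0 ->]; [apply: eq_big_seq => i is_; rewrite /e' is_|
    rewrite mul0r].
split.
  apply: (sub_finite_set _ (finite_seq s)) => i [_ /=].
  by apply: contra_neqT; exact: e'0.
split.
- by rewrite fsT// -e1; apply: eq_big_seq => i is_; rewrite /e' is_.
- by move=> j _; rewrite psumE.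
- by move=> i j [_]; rewrite !psumE => ei _ _ /ltW ij; exact: ep ei.
- by exists j1; rewrite ?psumE.
Qed.

(** * The complex modulus and the truncated Moebius map *)

Lemma normc_ge0 (R : realType) (z : R[i]) : 0 <= normc z.
Proof. by case: z => x y; rewrite sqrtr_ge0. Qed.

Lemma sqr_normcE (R : realType) (z : R[i]) :
  normc z ^+ 2 = complex.Re z ^+ 2 + complex.Im z ^+ 2.
Proof. by case: z => x y; rewrite sqr_sqrtr// addr_ge0// sqr_ge0. Qed.

Lemma normc_conj (R : realType) (z : R[i]) : normc z^*%C = normc z.
Proof. by case: z => x y; rewrite /= sqrrN. Qed.

Lemma normcX (R : realType) (z : R[i]) n : normc (z ^+ n) = normc z ^+ n.
Proof.
by elim: n => [|n IH]; rewrite ?Normc.normc1// !exprS Normc.normcM IH.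
Qed.

Lemma normc_real (R : realType) (x : R) : normc x%:C = `|x|.
Proof. by rewrite /= expr0n addr0 sqrtr_sqr. Qed.

Lemma normc_cis (R : realType) (x : R) : normc (cis x) = 1.
Proof. by rewrite /= cos2Dsin2 sqrtr1. Qed.

Lemma mulc_conj (R : realType) (z : R[i]) : z * z^*%C = (normc z ^+ 2)%:C.
Proof.
rewrite sqr_normcE; case: z => x y; apply/eqP; rewrite eq_complex /=.
by apply/andP; split; apply/eqP; ring.
Qed.

(** The identity by which the Moebius map preserves the unit disc: the right-hand side is positive
    when [w] and [g] lie in the open disc. *)
Lemma sqr_normc_mobius (R : realType) (w g : R[i]) :
  normc (1 + w^*%C * g) ^+ 2 - normc (g + w) ^+ 2 =
  (1 - normc g ^+ 2) * (1 - normc w ^+ 2).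
Proof. by rewrite !sqr_normcE; case: w => a b; case: g => c d /=; ring. Qed.

Lemma exists_expr_lt (R : realType) (r e : R) : 0 <= r < 1 -> 0 < e ->
  exists n, r ^+ n < e.
Proof.
move=> /andP[r0 r1] e0.
have /cvg_expr/cvgrPdist_lt/(_ e e0) [n _ rn] : `|r| < 1.
  by rewrite ger0_norm.
exists n; have := rn n (leqnn n).
by rewrite /= sub0r normrN ger0_norm// exprn_ge0.
Qed.

(* The sum is the truncated power series of the Moebius map
   [(g + w) / (1 + w^*%C * g)], which sends the disc of radius r into a disc of
   radius less than 1; this leaves room for the truncation error. *)
Lemma mobius_truncation (R : realType) (r p : R) : 0 <= r < 1 -> 0 <= p < 1 ->
  exists n r', 0 <= r' < 1 /\ forall w g : R[i], normc w = p -> normc g <= r ->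
    normc (w + (1 - w * w^*%C) *
      (g * \sum_(i < n.+1) (- (w^*%C * g)) ^+ i)) <= r'.
Proof.
move=> /andP[r0 r1] /andP[p0 p1].
pose d := (1 - r ^+ 2) * (1 - p ^+ 2).
have r2 : 0 <= r ^+ 2 < 1 by rewrite sqr_ge0 expr_lt1.
have p2 : 0 <= p ^+ 2 < 1 by rewrite sqr_ge0 expr_lt1.
have d0 : 0 < d by rewrite mulr_gt0// subr_gt0; lra.
have d1 : d <= 1 by rewrite /d; nra.
have d8 : 0 < d / 8 by lra.
have [|n rn] := exists_expr_lt _ d8 (r := r); first by rewrite r0.
(* With [A] and [D] the moduli of numerator and denominator, [d <= D ^+ 2 - A ^+ 2] and [A < D <= 2]
   give [A <= D - d / 4]. A truncation error of at most [d / 8] leaves [D - d / 8], which is at most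
   [D * (1 - d / 16)]. *)
exists n, (1 - d / 16); split; first lra.
move=> w g wp gr; set T := w + _.
have g0 := normc_ge0 g.
have wg : normc (w^*%C * g) <= r.
  rewrite Normc.normcM normc_conj wp -[leRHS]mul1r ler_pM//; exact: ltW.
pose A := normc (g + w); pose D := normc (1 + w^*%C * g).
have A0 : 0 <= A := normc_ge0 _.
have D0 : 0 <= D := normc_ge0 _.
have D2 : D <= 2.
  apply: le_trans (le_normcD _ _) _; rewrite Normc.normc1.
  by apply: le_trans (lerD (lexx _) wg) _; lra.
have AD : d <= D ^+ 2 - A ^+ 2.
  rewrite sqr_normc_mobius wp /d ler_wpM2r ?subr_ge0//; first by lra.
  by rewrite lerD2l lerN2 ler_pXn2r// nnegrE.
have ltAD : A < D by nra.
have dAD : d <= 4 * (D - A) by nra.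
(* Multiplying by the denominator telescopes the geometric sum: the exact numerator remains, up to
   one error term. *)
have geom : (1 + w^*%C * g) * T =
    (g + w) - (1 - w * w^*%C) * g * (- (w^*%C * g)) ^+ n.+1.
  have := subrX1 (- (w^*%C * g)) n.+1; rewrite /T;
    set S := \sum_(_ < _) _ => SE.
  have -> : (- (w^*%C * g)) ^+ n.+1 = 1 - (1 + w^*%C * g) * S.
    by rewrite -[LHS](subrK 1) SE; ring.
  by ring.
have TD : D * normc T <= A + d / 8.
  rewrite -Normc.normcM geom; apply: le_trans (le_normcD _ _) _.
  rewrite normcN lerD2l !Normc.normcM normcX normcN.
  apply: le_trans (ltW rn); rewrite -[leRHS]mul1r; apply: ler_pM.
  - by rewrite mulr_ge0// normc_ge0.
  - by rewrite exprn_ge0// normc_ge0.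
  - rewrite -[leRHS]mul1r ler_pM ?normc_ge0//;
      last by apply: le_trans gr (ltW _).
    rewrite mulc_conj wp -(rmorph1 (real_complex R)) -rmorphB normc_real.
    by rewrite ger0_norm; lra.
  - rewrite exprS; apply: le_trans (_ : 1 * r ^+ n <= _); last by rewrite mul1r.
    by rewrite ler_pM ?exprn_ge0 ?normc_ge0 ?lerXn2r ?nnegrE ?normc_ge0//; lra.
have Dpos : 0 < D by apply: le_lt_trans ltAD.
rewrite -(ler_pM2l Dpos); apply: le_trans TD _; nra.
Qed.

(** * Trigonometric polynomials with prescribed frequencies *)

(** The minus sign makes the integral of [f * mode m] equal to [2 * pi] times the Fourier
    coefficient of [f] at [m]. *)
Definition mode (R : realType) (m : int) (t : R) : R[i] := cis (- (m%:~R * t)).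

Lemma mode0 (R : realType) (t : R) : mode 0 t = 1.
Proof. by rewrite /mode mul0r oppr0 /cis cos0 sin0. Qed.

Lemma modeD (R : realType) (m n : int) (t : R) :
  mode (m + n) t = mode m t * mode n t.
Proof.
rewrite /mode intrD mulrDl opprD /cis cosD sinD; apply/eqP.
by rewrite eq_complex /= eqxx; apply/eqP; ring.
Qed.

Lemma modeN (R : realType) (m : int) (t : R) : mode (- m) t = (mode m t)^*%C.
Proof. by rewrite /mode mulrNz mulNr opprK /cis /= cosN sinN opprK. Qed.

(** Frequencies may repeat, so products and sums need no collecting of terms. *)
Inductive trigpoly (R : realType) (S : set int) : (R -> R[i]) -> Prop :=
| trigpoly0 : trigpoly S (fun=> 0)
| trigpoly_cons c m p : S m -> trigpoly S p ->
    trigpoly S (fun t => c * mode m t + p t).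

Lemma sub_trigpoly (R : realType) (S S' : set int) (p : R -> R[i]) :
  S `<=` S' -> trigpoly S p -> trigpoly S' p.
Proof.
move=> SS'; elim=> [|c m q Sm _ IH]; first exact: trigpoly0.
by apply: trigpoly_cons => //; exact: SS'.
Qed.

Lemma trigpoly_mode (R : realType) (S : set int) (c : R[i]) (m : int) :
  S m -> trigpoly S (fun t : R => c * mode m t).
Proof.
move=> Sm; rewrite (_ : (fun _ => _) = (fun t => c * mode m t + 0)).
  exact/trigpoly_cons/trigpoly0.
by apply/funext => t; rewrite addr0.
Qed.

Lemma trigpolyD (R : realType) (S : set int) (p q : R -> R[i]) :
  trigpoly S p -> trigpoly S q -> trigpoly S (fun t => p t + q t).
Proof.
move=> + Sq; elim=> [|c m p' Sm _ IH].
  by rewrite (_ : (fun _ => _) = q)//; apply/funext => t; rewrite add0r.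
rewrite (_ : (fun _ => _) = (fun t => c * mode m t + (p' t + q t))).
  exact: trigpoly_cons.
by apply/funext => t; rewrite addrA.
Qed.

Lemma trigpoly_sum (R : realType) (S : set int) (I : eqType) (s : seq I)
    (p : I -> R -> R[i]) : {in s, forall i, trigpoly S (p i)} ->
  trigpoly S (fun t => \sum_(i <- s) p i t).
Proof.
elim: s => [|i s IH] Sp.
  rewrite (_ : (fun _ => _) = (fun=> 0)); first exact: trigpoly0.
  by apply/funext => t; rewrite big_nil.
rewrite (_ : (fun _ => _) = (fun t => p i t + \sum_(j <- s) p j t)).
  apply: trigpolyD; first by apply: Sp; rewrite mem_head.
  by apply: IH => j js; apply: Sp; rewrite inE js orbT.
by apply/funext => t; rewrite big_cons.
Qed.

Lemma trigpolyM (R : realType) (S S' S'' : set int) (p q : R -> R[i]) :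
  (forall m n, S m -> S' n -> S'' (m + n)) ->
  trigpoly S p -> trigpoly S' q -> trigpoly S'' (fun t => p t * q t).
Proof.
move=> SS' Sp Sq; elim: Sp => [|c m p' Sm _ IHp].
  rewrite (_ : (fun _ => _) = (fun=> 0)); first exact: trigpoly0.
  by apply/funext => t; rewrite mul0r.
rewrite (_ : (fun _ => _) = (fun t => c * mode m t * q t + p' t * q t)).
  apply: trigpolyD IHp; elim: Sq => [|d n q' Sn _ IHq].
    rewrite (_ : (fun _ => _) = (fun=> 0)); first exact: trigpoly0.
    by apply/funext => t; rewrite mulr0.
  rewrite (_ : (fun _ => _) =
      (fun t => (c * d) * mode (m + n) t + c * mode m t * q' t)).
    by apply: trigpoly_cons => //; exact: SS'.
  by apply/funext => t; rewrite modeD; ring.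
by apply/funext => t; rewrite mulrDl.
Qed.

Lemma trigpolyZ (R : realType) (S : set int) (c : R[i]) (p : R -> R[i]) :
  trigpoly S p -> trigpoly S (fun t => c * p t).
Proof.
elim=> [|d m q Sm _ IH].
  rewrite (_ : (fun _ => _) = (fun=> 0)); first exact: trigpoly0.
  by apply/funext => t; rewrite mulr0.
rewrite (_ : (fun _ => _) = (fun t => (c * d) * mode m t + c * q t)).
  exact: trigpoly_cons.
by apply/funext => t; rewrite mulrDr mulrA.
Qed.

(** * Frequencies of powers and the Schur algorithm *)

Lemma trigpolyX (R : realType) (k : int -> int) (s : seq int) (b : int)
    (p : R -> R[i]) (n : nat) : trigpoly (reach k s b 1) p ->
  trigpoly (reach k s b n.+1%:Z) (fun t => p t ^+ n.+1).
Proof.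
move=> Sp; elim: n => [|n IH]; first exact: Sp.
rewrite (_ : (fun _ => _) = (fun t => p t * p t ^+ n.+1)); last first.
  by apply/funext => t; rewrite exprS.
by apply: trigpolyM Sp IH => m m'; rewrite [n.+2%:Z]intS; exact: reachD.
Qed.

Lemma modeX (R : realType) (m : int) (n : nat) (t : R) :
  mode m t ^+ n = mode (n%:Z * m) t.
Proof.
elim: n => [|n IH]; first by rewrite mul0r mode0.
by rewrite exprS IH -modeD intS mulrDl mul1r.
Qed.

(** The factor [g ^+ n.+2] has frequencies of total [n + 2], from which the modes subtract [n + 1]
    copies of [k b]: the situation of [reach_overshoot]. *)
Lemma trigpoly_overshoot (R : realType) (J : set int) (k : int -> int)
    (s : seq int) (b b' : int) (a : R[i]) (g : R -> R[i]) (n : nat) :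
  int_interval J -> uniq s -> [set` s] `<=` J -> b \in s -> b < b' ->
  trigpoly (reach k s b 1) g ->
  trigpoly (overshoot J k s b')
    (fun t => g t * (a * mode (- k b) t * g t) ^+ n.+1).
Proof.
move=> iJ us sJ bs bb' Sg.
rewrite (_ : (fun _ => _) = fun t => g t ^+ n.+2 *
    (a ^+ n.+1 * mode (n.+1%:Z * - k b) t)); last first.
  by apply/funext => t; rewrite -modeX !exprMn [g t ^+ _.+2]exprS; ring.
apply: trigpolyM (trigpolyX n.+1 Sg)
  (trigpoly_mode (S := [set n.+1%:Z * - k b]) _ erefl).
move=> m m' gm ->; have := reach_overshoot iJ us sJ bs bb' _ gm.
by rewrite [n.+2%:Z]intS [1 + _]addrC addrK mulrN; apply; lia.
Qed.

(** Induction on [l], adding its largest index last so that all earlier indices lie before it. The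
    strict bound [r < 1] leaves room for the next truncation. *)
Lemma schur_trigpoly (R : realType) (J : set int) (k : int -> int)
    (s l : seq int) (c : int -> R[i]) :
  int_interval J -> uniq s -> [set` s] `<=` J ->
  sorted <%R l -> {subset l <= s} ->
  2 * \sum_(i <- l) normc (c i) ^+ 2 < 1 ->
  exists (g q : R -> R[i]) (r : R),
    [/\ 0 <= r < 1, forall t, normc (g t) <= r,
        forall b, {in l, forall i, i < b} -> trigpoly (overshoot J k s b) q &
        forall t, g t = \sum_(i <- l) c i * mode (k i) t + q t].
Proof.
move=> iJ us sJ; elim/last_ind: l c => [|l b IH] c.
  move=> _ _ _; exists (fun=> 0), (fun=> 0), 0; split.
  - by rewrite lexx ltr01.
  - by move=> t; rewrite Normc.normc0.
  - by move=> b _; exact: trigpoly0.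
  - by move=> t; rewrite big_nil addr0.
move=> sl ls; rewrite big_rcons /= => cl.
have [sl' lb] : sorted <%R l /\ {in l, forall i, i < b}.
  move: sl; rewrite lt_sorted_pairwise pairwise_rcons => /andP[/allP lb].
  by rewrite -lt_sorted_pairwise.
have bs : b \in s by apply: ls; rewrite mem_rcons mem_head.
set a := c b in cl *; set p := normc a in cl.
have sum0 : 0 <= \sum_(i <- l) normc (c i) ^+ 2.
  by apply: sumr_ge0 => i _; exact: sqr_ge0.
have p2 : 2 * p ^+ 2 < 1 by lra.
have p0 : 0 <= p := normc_ge0 a.
have p1 : p < 1 by nra.
pose u : R := 1 - p ^+ 2.
have u0 : 0 < u by rewrite /u; lra.
pose c' i := u^-1%:C * c i.
have [||g [q [r [r01 gr Sq gE]]]] := IH c' sl'.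
  by move=> i il; apply: ls; rewrite mem_rcons inE il orbT.
  (* The rescaled coefficients stay admissible because twice the sum over [l] is less than
     [1 - 2 * p ^+ 2], hence less than [u ^+ 2]. *)
  under eq_bigr do rewrite /c' Normc.normcM normc_real exprMn.
  rewrite -mulr_sumr real_normK ?num_real// mulrCA exprVn.
  rewrite ltr_pdivrMl ?exprn_gt0// mulr1.
  by rewrite /u; nra.
have [n [r' [r'01 hr']]] := mobius_truncation r01 (introT andP (conj p0 p1)).
pose w t := a * mode (k b) t.
have wp t : normc (w t) = p by rewrite Normc.normcM normc_cis mulr1.
have wJ t : (w t)^*%C = a^*%C * mode (- k b) t by rewrite modeN /w rmorphM.
have ww t : 1 - w t * (w t)^*%C = u%:C by rewrite mulc_conj wp rmorphB rmorph1.
(* The new remainder: the old one, rescaled by the term of index 0, and the terms of index at least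
   1 of the truncated series. *)
pose rest t := u%:C * q t +
  u%:C * \sum_(i < n) g t * (- a^*%C * mode (- k b) t * g t) ^+ i.+1.
exists (fun t => w t + (1 - w t * (w t)^*%C) *
  (g t * \sum_(i < n.+1) (- ((w t)^*%C * g t)) ^+ i)), rest, r'; split => //.
- by move=> t; exact: hr'.
- move=> b' lb'; have bb' : b < b' by apply: lb'; rewrite mem_rcons mem_head.
  have Sq' := Sq b lb.
  (* Both the main frequencies [k i] and those of [q] have coefficients of total 1 supported before
     [b]. *)
  have Sg : trigpoly (reach k s b 1) g.
    rewrite (_ : g = fun t => \sum_(i <- l) c' i * mode (k i) t + q t).
      apply: trigpolyD; last exact: sub_trigpoly (@overshoot_reach _ _ _ _) Sq'.
      apply: trigpoly_sum => i il; apply: trigpoly_mode.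
      by apply: reach_index (lb i il) => //; apply: ls;
        rewrite mem_rcons inE il orbT.
    exact/funext.
  apply: trigpolyD.
    apply: trigpolyZ; apply: sub_trigpoly Sq'.
    exact/overshoot_widen/ltW.
  apply: trigpolyZ; apply: trigpoly_sum => i _.
  exact: trigpoly_overshoot.
- move=> t; rewrite ww wJ -!mulNr big_ord_recl expr0 big_rcons /= /rest.
  have -> : \sum_(i <- l) c i * mode (k i) t =
      u%:C * \sum_(i <- l) c' i * mode (k i) t.
    rewrite mulr_sumr; apply: eq_bigr => i _.
    by rewrite /c' !mulrA -rmorphM divff ?gt_eqF// rmorph1 mul1r.
  rewrite -mulr_sumr mulrDr mulr1 {1}gE /w -/a.
  by ring.
Qed.

(** * Integration of complex functions on the circle *)

Lemma ReM (R : realType) (z w : R[i]) : complex.Re (z * w) =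
  complex.Re z * complex.Re w - complex.Im z * complex.Im w.
Proof. by case: z => a b; case: w => c d. Qed.

Lemma ImM (R : realType) (z w : R[i]) : complex.Im (z * w) =
  complex.Re z * complex.Im w + complex.Im z * complex.Re w.
Proof. by case: z => a b; case: w => c d /=; ring. Qed.

Lemma ReD (R : realType) (z w : R[i]) :
  complex.Re (z + w) = complex.Re z + complex.Re w.
Proof. by case: z => a b; case: w. Qed.

Lemma ImD (R : realType) (z w : R[i]) :
  complex.Im (z + w) = complex.Im z + complex.Im w.
Proof. by case: z => a b; case: w. Qed.

Lemma ler_Re_normc (R : realType) (z : R[i]) : complex.Re z <= normc z.
Proof.
apply: le_trans (ler_norm _) _; rewrite -sqrtr_sqr; case: z => a b /=.
by rewrite ler_wsqrtr// lerDl sqr_ge0.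
Qed.

Lemma normc_le_ReIm (R : realType) (z : R[i]) :
  normc z <= `|complex.Re z| + `|complex.Im z|.
Proof.
case: z => a b /=; rewrite -[leRHS]ger0_norm ?addr_ge0//.
rewrite -sqrtr_sqr ler_wsqrtr//.
by rewrite sqrrD !real_normK ?num_real// lerD2r lerDl mulrn_wge0// mulr_ge0.
Qed.

Lemma measurable_circle (R : realType) :
  measurable (circle R : set (measurableTypeR R)).
Proof. exact: measurable_itv. Qed.

Lemma integrable_circleD (R : realType) (f g : R -> R[i]) :
  integrable_circle f -> integrable_circle g ->
  integrable_circle (fun t => f t + g t).
Proof.
move=> [fr fi] [gr gi]; have mC := @measurable_circle R; split.
- under eq_fun do rewrite ReD EFinD.
  exact: (integrableD mC fr gr).
- under eq_fun do rewrite ImD EFinD.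
  exact: (integrableD mC fi gi).
Qed.

Lemma integrable_circleM (R : realType) (f g : R -> R[i]) :
  integrable_circle f ->
  measurable_fun (circle R) (fun t => complex.Re (g t)) ->
  measurable_fun (circle R) (fun t => complex.Im (g t)) ->
  [bounded complex.Re (g t) | t in circle R] ->
  [bounded complex.Im (g t) | t in circle R] ->
  integrable_circle (fun t => f t * g t).
Proof.
move=> [fr fi] mr mi br bi; have mC := @measurable_circle R.
have frr := integrableMl mC fr mr br; have fri := integrableMl mC fr mi bi.
have fir := integrableMl mC fi mr br; have fii := integrableMl mC fi mi bi.
split.
- under eq_fun do rewrite ReM EFinB !EFinM.
  exact: (integrableB mC frr fii).
- under eq_fun do rewrite ImM EFinD !EFinM.
  exact: (integrableD mC fri fir).
Qed.

Lemma integrable_circleZ (R : realType) (c : R[i]) (f : R -> R[i]) :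
  integrable_circle f -> integrable_circle (fun t => c * f t).
Proof.
move=> fL1; under eq_fun do rewrite mulrC.
by apply: integrable_circleM => //; exact: bounded_cst.
Qed.

Lemma cintegralD (R : realType) (f g : R -> R[i]) :
  integrable_circle f -> integrable_circle g ->
  cintegral (fun t => f t + g t) = cintegral f + cintegral g.
Proof.
move=> [fr fi] [gr gi]; have mC := @measurable_circle R.
rewrite /cintegral; congr Complex.
- rewrite -(RintegralD mC)//.
  by apply: eq_Rintegral => t _; rewrite ReD.
- rewrite -(RintegralD mC)//.
  by apply: eq_Rintegral => t _; rewrite ImD.
Qed.

Lemma cintegralZ (R : realType) (c : R[i]) (f : R -> R[i]) :
  integrable_circle f -> cintegral (fun t => c * f t) = c * cintegral f.
Proof.
move=> [fr fi]; have mC := @measurable_circle R.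
rewrite /cintegral; apply/eqP; rewrite eq_complex ReM ImM /=.
have Zr r := integrableZl mC r fr; have Zi r := integrableZl mC r fi.
rewrite -!(RintegralZl _ mC fr) -!(RintegralZl _ mC fi).
rewrite -(RintegralB mC (Zr _) (Zi _)) -(RintegralD mC (Zi _) (Zr _)).
by apply/andP; split; apply/eqP; apply: eq_Rintegral => t _; rewrite ?ReM ?ImM.
Qed.

Lemma cintegral0 (R : realType) : cintegral (fun=> 0 : R[i]) = 0.
Proof.
by rewrite /cintegral !Rintegral_cst ?mul0r//; exact: measurable_circle.
Qed.

Lemma integrable_circle_mode (R : realType) (f : R -> R[i]) (m : int) :
  integrable_circle f -> integrable_circle (fun t => f t * mode m t).
Proof.
have lin : continuous (fun t : R => - (m%:~R * t)).
  by move=> t; apply: continuousN; apply: mulrl_continuous.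
move=> fL1; apply: integrable_circleM => //=.
- apply: measurable_funTS; apply: continuous_measurable_fun => t.
  by apply: continuous_comp; [exact: lin|exact: continuous_cos].
- apply: measurable_funTS; apply: continuous_measurable_fun => t.
  by apply: continuous_comp; [exact: lin|exact: continuous_sin].
- exists 1; split=> [|x x1 t _ /=]; first exact: num_real.
  by apply: le_trans (ltW x1); rewrite ler_norml cos_geN1 cos_le1.
- exists 1; split=> [|x x1 t _ /=]; first exact: num_real.
  by apply: le_trans (ltW x1); rewrite ler_norml sin_geN1 sin_le1.
Qed.

Lemma integrable_circle_trigpoly (R : realType) (f : R -> R[i]) (S : set int)
    (p : R -> R[i]) :
  integrable_circle f -> trigpoly S p -> integrable_circle (fun t => f t * p t).
Proof.
move=> fL1; elim=> [|c m q _ _ IH].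
  under eq_fun do rewrite mulr0.
  by split; exact: integrable0.
under eq_fun do rewrite mulrDr mulrCA.
by apply/integrable_circleD/IH/integrable_circleZ/integrable_circle_mode.
Qed.

Lemma cintegral_mode (R : realType) (f : R -> R[i]) (m : int) :
  cintegral (fun t => f t * mode m t) = (2 * pi)%:C * fourier_coef f m.
Proof.
rewrite /fourier_coef mulrA -rmorphM divff ?rmorph1 ?mul1r//.
by rewrite mulf_neq0// gt_eqF// pi_gt0.
Qed.

Lemma cintegral_trigpoly0 (R : realType) (f : R -> R[i]) (S : set int)
    (p : R -> R[i]) : integrable_circle f ->
  (forall m, S m -> fourier_coef f m = 0) -> trigpoly S p ->
  cintegral (fun t => f t * p t) = 0.
Proof.
move=> fL1 fS; elim=> [|c m q Sm Sq IH].
  by under eq_fun do rewrite mulr0; rewrite cintegral0.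
under eq_fun do rewrite mulrDr mulrCA.
rewrite cintegralD.
- rewrite cintegralZ; last exact: integrable_circle_mode.
  by rewrite cintegral_mode fS// !mulr0 add0r.
- exact/integrable_circleZ/integrable_circle_mode.
- exact: integrable_circle_trigpoly Sq.
Qed.

Lemma cintegral_sum_mode (R : realType) (f : R -> R[i]) (l : seq int)
    (k : int -> int) (c : int -> R[i]) : integrable_circle f ->
  cintegral (fun t => f t * \sum_(i <- l) c i * mode (k i) t) =
  (2 * pi)%:C * \sum_(i <- l) c i * fourier_coef f (k i).
Proof.
move=> fL1; elim: l => [|i l IH].
  under eq_fun do rewrite big_nil mulr0.
  by rewrite cintegral0 big_nil mulr0.
under eq_fun do rewrite big_cons mulrDr mulrCA.
rewrite cintegralD.
- rewrite IH cintegralZ; last exact: integrable_circle_mode.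
  by rewrite cintegral_mode big_cons; ring.
- exact/integrable_circleZ/integrable_circle_mode.
- apply: (@integrable_circle_trigpoly _ _ setT) => //.
  by apply: trigpoly_sum => j _; exact: trigpoly_mode.
Qed.

(** * The norm of L^1 and its duality with bounded functions *)

Lemma integrable_normc (R : realType) (f : R -> R[i]) : integrable_circle f ->
  mu.-integrable (circle R) (fun t => (normc (f t))%:E).
Proof.
move=> [fr fi].
have mr : measurable_fun (circle R) (fun t => complex.Re (f t)).
  by apply/measurable_EFinP; exact: (measurable_int _ fr).
have mi : measurable_fun (circle R) (fun t => complex.Im (f t)).
  by apply/measurable_EFinP; exact: (measurable_int _ fi).
have mn : measurable_fun (circle R) (fun t => normc (f t)).
  rewrite (_ : (fun _ => _) = Num.sqrt \o
      (fun t => complex.Re (f t) ^+ 2 + complex.Im (f t) ^+ 2)).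
    apply: measurableT_comp.
      by apply: continuous_measurable_fun; exact: sqrt_continuous.
    by apply: measurable_funD; exact: measurable_funX.
  by apply/funext => t /=; case: (f t).
have mC := @measurable_circle R.
apply: (le_integrable mC _ _
  (integrableD mC (integrable_abse fr) (integrable_abse fi))).
- by apply/measurable_EFinP.
- move=> t _ /=; rewrite lee_fin ger0_norm ?normc_ge0//.
  by rewrite ger0_norm ?addr_ge0// normc_le_ReIm.
Qed.

(** Integrability makes the extended real [norm1 f] finite, so that real integrals can be
    compared. *)
Lemma fine_norm1 (R : realType) (f : R -> R[i]) : integrable_circle f ->
  norm1 f = ((2 * pi)^-1 * \int[mu]_(t in circle R) normc (f t))%:E.
Proof.
move=> /integrable_normc fL1; rewrite /norm1 EFinM fineK//.
exact: (integrable_fin_num (@measurable_circle R) fL1).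
Qed.

Lemma Re_cintegral_le (R : realType) (f g : R -> R[i]) :
  integrable_circle f -> integrable_circle (fun t => f t * g t) ->
  (forall t, normc (g t) <= 1) ->
  (((2 * pi)^-1 * complex.Re (cintegral (fun t => f t * g t)))%:E <= norm1 f)%E.
Proof.
move=> fL1 fgL1 g1.
rewrite fine_norm1// lee_fin ler_wpM2l ?invr_ge0 ?mulr_ge0 ?pi_ge0//.
apply: (le_Rintegral (@measurable_circle R) fgL1.1
  (integrable_normc fL1)) => t _.
apply: le_trans (ler_Re_normc _) _.
by rewrite Normc.normcM ler_piMr// normc_ge0.
Qed.

Lemma norm1_ge0 (R : realType) (f : R -> R[i]) : (0 <= norm1 f)%E.
Proof.
rewrite /norm1 mule_ge0 ?lee_fin ?invr_ge0 ?mulr_ge0 ?pi_ge0//.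
by apply: integral_ge0 => t _; rewrite lee_fin normc_ge0.
Qed.

(** * The estimate for finitely many indices and the passage to all of K *)

Lemma seq_int_ubound (s : seq int) : exists b, {in s, forall i, i < b}.
Proof.
elim: s => [|i s [b sb]]; first by exists 0.
exists (Num.max b (i + 1)) => j; rewrite inE => /orP[/eqP ->|/sb jb].
  by rewrite lt_max ltrDl orbT.
by rewrite lt_max jb.
Qed.

Lemma sqrt_sum_fourier_coef_le (R : realType) (f : R -> R[i]) (J : set int)
    (k : int -> int) (s : seq int) : integrable_circle f ->
  (forall m, Sch J k m -> fourier_coef f m = 0) ->
  int_interval J -> sorted <%R s -> [set` s] `<=` J ->
  ((Num.sqrt (\sum_(i <- s) normc (fourier_coef f (k i)) ^+ 2))%:E
     <= 2%:E * norm1 f)%E.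
Proof.
move=> fL1 fSch iJ ss sJ; set S := \sum_(i <- s) _.
have us := lt_sorted_uniq ss.
(* The degenerate case is set apart because [N] is inverted below. *)
have [S0|S0] := leP S 0.
  by rewrite (ler0_sqrtr S0) mule_ge0// norm1_ge0.
set N := Num.sqrt S; have N0 : 0 < N by rewrite sqrtr_gt0.
have NS : N ^+ 2 = S by rewrite sqr_sqrtr// ltW.
(* The conjugates make the pairing with [f] a sum of squares. The factor gives
   [2 * sum |c_i|^2 = 1/2], within the strict bound of [schur_trigpoly]. *)
pose c i := (2 * N)^-1%:C * (fourier_coef f (k i))^*%C.
have [|g [q [r [/andP[_ r1] gr Sq gE]]]] :=
    @schur_trigpoly R J k s s c iJ us sJ ss (fun _ => id).
  under eq_bigr do rewrite Normc.normcM normc_real normc_conj exprMn.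
  rewrite -mulr_sumr -/S real_normK ?num_real// exprVn exprMn NS.
  by rewrite invfM -mulrA mulVf ?gt_eqF//; lra.
have [b sb] := seq_int_ubound s.
have q0 : cintegral (fun t => f t * q t) = 0.
  apply: (cintegral_trigpoly0 fL1 _ (Sq b sb)) => m qm.
  exact/fSch/(overshoot_Sch us sJ qm).
have sumL1 : integrable_circle
    (fun t => f t * \sum_(i <- s) c i * mode (k i) t).
  apply: (@integrable_circle_trigpoly _ _ setT) => //.
  by apply: trigpoly_sum => i _; exact: trigpoly_mode.
have qL1 := integrable_circle_trigpoly fL1 (Sq b sb).
have fgE : (fun t => f t * g t) =
    (fun t => f t * (\sum_(i <- s) c i * mode (k i) t) + f t * q t).
  by apply/funext => t; rewrite gE mulrDr.
have fgL1 : integrable_circle (fun t => f t * g t).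
  by rewrite fgE; exact: integrable_circleD.
have := Re_cintegral_le fL1 fgL1 (fun t => le_trans (gr t) (ltW r1)).
(* The remainder [q] integrates to 0 against [f]; the main sum contributes [2 * pi * S / (2 * N)],
   and this [N / 2] is the source of the constant 2. *)
have -> : cintegral (fun t => f t * g t) = (2 * pi * (N / 2))%:C.
  rewrite fgE cintegralD// q0 addr0 cintegral_sum_mode// [RHS]rmorphM.
  congr (_ * _); rewrite (_ : N / 2 = (2 * N)^-1 * S); last first.
    by rewrite -NS; field; rewrite gt_eqF.
  rewrite rmorphM /= /S rmorph_sum mulr_sumr; apply: eq_bigr => i _.
  by rewrite /c -mulrA [_^*%C * _]mulrC mulc_conj.
rewrite mulKf ?mulf_neq0 ?gt_eqF ?pi_gt0// => Nle.
have -> : N%:E = (2%:E * (N / 2)%:E)%E by rewrite -EFinM; congr EFin; field.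
by rewrite lee_pmul2l.
Qed.

Theorem theorem5p1 (R : realType) (K : set int) (f : R -> R[i])
  (f_L1 : integrable_circle f)
  (f_Sch : exists (J : set int) (k : int -> int),
    enumeration K J k /\ forall m, Sch J k m -> fourier_coef f m = 0) :
  (sqrte (\esum_(k in K) (Normc.normc (fourier_coef f k) ^+ 2)%:E)
     <= 2%:E * norm1 f)%E.
Proof.
have [J [k [[iJ [kJ _ kK]] fSch]]] := f_Sch.
have norm0 : (0 <= 2%:E * norm1 f)%E by rewrite mule_ge0// norm1_ge0.
rewrite -[leRHS]gee0_abs// -sqrte_sqr lee_sqrt ?sqre_ge0//.
(* The sum over [K] is a supremum over finite subsets [X], so each of these is bounded
   separately. *)
apply: ge_ereal_sup => _ [X [/finite_seqP [u XE] XK] <-].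
(* An index for each frequency; the default 0 is never taken on [X], as [k] maps [J] onto [K]. *)
pose h x := xget 0 [set j | J j /\ k j = x].
have hP x : X x -> J (h x) /\ k (h x) = x.
  move=> /XK /kK [j Jj kj].
  exact: (@xgetPex _ 0 [set j | J j /\ k j = x] (ex_intro _ j (conj Jj kj))).
have uX x : x \in undup u -> X x by rewrite mem_undup XE.
(* The algorithm needs the indices in increasing order, whatever the order of the frequencies; they
   are distinct because [k] inverts [h] on [X]. *)
pose s := sort <=%R (map h (undup u)).
have ss : sorted <%R s.
  rewrite sort_lt_sorted map_inj_in_uniq ?undup_uniq// => x y /uX /hP [_ kx].
  by move=> /uX /hP [_ ky] hxy; rewrite -kx -ky hxy.
have sJ : [set` s] `<=` J.
  by move=> i /=; rewrite mem_sort => /mapP [x /uX /hP [Jx _] ->].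
have := sqrt_sum_fourier_coef_le f_L1 fSch iJ ss sJ.
rewrite (perm_big _ (permEl (perm_sort _ _))) big_map.
under eq_big_seq => x /uX /hP [_ ->] do over.
set S := \sum_(x <- _) _ => Sle.
have -> : (\sum_(x \in X) (normc (fourier_coef f x) ^+ 2)%:E = S%:E)%E.
  rewrite (_ : X = [set` undup u]) -?fsbig_seq ?undup_uniq ?sumEFin//.
  by rewrite XE; apply/seteqP; split=> x /=; rewrite mem_undup.
have S0 : 0 <= S by apply: sumr_ge0 => x _; exact: sqr_ge0.
rewrite -(sqr_sqrtr S0) EFin_expe.
by rewrite lee_sqr.
Qed.
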